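(* Let $d \geq 2$ and let $P \subset \mathbb{R}^{d}$ be a closed convex cone which is pointed ($P \cap -P=\{0\}$) and spanning ($P-P=\mathbb{R}^{d}$). Let $A$ be a $P$-module, $k \in \{1,2,\dots\}\cup\{\infty\}$, and $\mathcal{K}$ a separable Hilbert space of dimension $k$. Let $V:P\to B(L^{2}(A)\otimes\mathcal{K})$ be the isometric representation associated to the $P$-module $A$ of multiplicity $k$. Suppose that $\xi=\{\xi_x\}_{x\in P}$ is an additive cocycle of $V$. Then $\xi_x=0$ for every $x \in P$.
   Context: $P$-module: a proper closed subset $A \subset \mathbb{R}^{d}$ with $A+x \subset A$ for all $x \in P$ and, by convention, $0 \in A$. The isometric representation associated to $A$ of multiplicity $k$ acts on $L^2(A,\mathcal{K})\cong L^2(A)\otimes\mathcal{K}$ (Lebesgue measure) by $(V_xf)(y)=f(y-x)$ if $y-x\in A$ and $(V_xf)(y)=0$ if $y-x\notin A$, for $x \in P$. Additive cocycle of a strongly continuous isometric representation $V:P\to B(\mathcal{H})$: a map $\xi:P\to\mathcal{H}$, $x\mapsto\xi_x$, such that (i) $\xi_x+V_x\xi_y=\xi_{x+y}$ for $x,y\in P$; (ii) $V_x^{*}\xi_x=0$ for $x\in P$; (iii) $\xi$ is continuous for the norm topology on $\mathcal{H}$. *)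

(* Defs.v *)
From HB Require Import structures.
From mathcomp Require Import all_boot all_order all_algebra complex.
From mathcomp Require Import all_classical all_reals all_analysis.
Set Implicit Arguments.
Unset Strict Implicit.
Unset Printing Implicit Defensive.
Import Order.TTheory GRing.Theory Num.Theory.
Import numFieldNormedType.Exports.
Local Open Scope classical_set_scope.
Local Open Scope ring_scope.

(* R^d is 'rV[R]_d. Its sigma-algebra is generated by the coordinate maps, as
   in the library's instance for tuples; it is the Borel sigma-algebra. *)
Section measurable_rV.
Context {R : realType} (n : nat).

Definition rV_coord (i : 'I_n) (v : 'rV[R]_n) : R := v ord0 i.

Let rV_set0 : g_sigma_preimage rV_coord set0.
Proof. exact: sigma_algebra0. Qed.

Let rV_setC (A : set 'rV[R]_n) :
  g_sigma_preimage rV_coord A -> g_sigma_preimage rV_coord (~` A).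
Proof. exact: sigma_algebraC. Qed.

Let rV_bigcup (F : (set 'rV[R]_n)^nat) :
  (forall i, g_sigma_preimage rV_coord (F i)) ->
  g_sigma_preimage rV_coord (\bigcup_i (F i)).
Proof. exact: sigma_algebra_bigcup. Qed.

HB.instance Definition _ := @isMeasurable.Build
  default_measure_display 'rV[R]_n (g_sigma_preimage rV_coord)
  rV_set0 rV_setC rV_bigcup.

Lemma measurable_rV_coord (i : 'I_n) : measurable_fun setT (rV_coord i).
Proof.
move=> _ Y mY; rewrite setTI; apply: sub_sigma_algebra => /=.
rewrite -bigcup_seq/=; exists i => /=; first by rewrite mem_index_enum.
by exists Y => //; rewrite setTI.
Qed.

Lemma measurable_fun_rV d (T : measurableType d) (f : T -> 'rV[R]_n) :
  (forall i, measurable_fun setT (rV_coord i \o f)) -> measurable_fun setT f.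
Proof.
move=> mf _ A mA; rewrite setTI.
have : preimage_set_system setT f (g_sigma_preimage rV_coord) `<=` measurable.
  rewrite -g_sigma_preimage_comp; apply: smallest_sub.
    exact: sigma_algebra_measurable.
  rewrite -bigcup_seq => B [i _] [C mC <-]; exact: mf.
by apply; exists A => //; rewrite setTI.
Qed.
End measurable_rV.

Section lebesgue_rV.
Context {R : realType}.

Definition rV_cons n (p : R * 'rV[R]_n) : 'rV[R]_n.+1 :=
  row_mx (\row_(_ < 1) p.1) p.2.

Lemma rV_cons0 n (p : R * 'rV[R]_n) : rV_coord ord0 (rV_cons p) = p.1.
Proof.
have -> : ord0 = lshift n (ord0 : 'I_1) by exact/val_inj.
by rewrite /rV_coord /rV_cons (row_mxEl (\row_(_ < 1) p.1)) mxE.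
Qed.

Lemma rV_consS n (p : R * 'rV[R]_n) i :
  rV_coord (lift ord0 i) (rV_cons p) = rV_coord i p.2.
Proof.
have -> : lift ord0 i = rshift 1 i by exact/val_inj.
by rewrite /rV_coord /rV_cons (row_mxEr (\row_(_ < 1) p.1)).
Qed.

Lemma measurable_rV_cons n : measurable_fun setT (@rV_cons n).
Proof.
apply: measurable_fun_rV => i; case: (unliftP ord0 i) => [j|] ->.
  rewrite (_ : _ \o _ = rV_coord j \o snd); last first.
    by apply/funext => p; exact: rV_consS.
  by apply: measurableT_comp => //; exact: measurable_rV_coord.
rewrite (_ : _ \o _ = fst) //; last by apply/funext => p; exact: rV_cons0.
Qed.

Lemma rV_cons_bij n : exists g : 'rV[R]_n.+1 -> R * 'rV[R]_n,
  [/\ cancel g (@rV_cons n), cancel (@rV_cons n) g & measurable_fun setT g].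
Proof.
exists (fun v => (rV_coord ord0 v, \row_j rV_coord (lift ord0 j) v)); split.
- move=> v; apply/rowP => i; rewrite -!/(rV_coord _ _).
  case: (unliftP ord0 i) => [j|] ->; last by rewrite rV_cons0.
  by rewrite rV_consS/= /rV_coord mxE.
- move=> [t v]; congr pair; first by rewrite rV_cons0.
  by apply/rowP => i; rewrite mxE rV_consS.
- apply: measurable_fun_pair; first exact: measurable_rV_coord.
  apply: measurable_fun_rV => i.
  rewrite (_ : _ \o _ = rV_coord (lift ord0 i)).
    exact: measurable_rV_coord.
  by apply/funext => v; rewrite /= /rV_coord mxE.
Qed.

Local Open Scope ereal_scope.

Definition lebesgue_cons n (mu : {sigma_finite_measure set 'rV[R]_n -> \bar R}) :
    set 'rV[R]_n.+1 -> \bar R :=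
  pushforward (@lebesgue_measure R \x mu) (@rV_cons n).

Section lebesgue_cons_measure.
Context n (mu : {sigma_finite_measure set 'rV[R]_n -> \bar R}).

Let mf := @measurable_rV_cons n.

Let lebesgue_cons0 : lebesgue_cons mu set0 = 0.
Proof. by rewrite /lebesgue_cons /pushforward preimage_set0 measure0. Qed.

Let lebesgue_cons_ge0 A : 0 <= lebesgue_cons mu A.
Proof. by rewrite /lebesgue_cons /pushforward measure_ge0. Qed.

Let lebesgue_cons_sigma_additive : semi_sigma_additive (lebesgue_cons mu).
Proof.
move=> G mG tG mUG; rewrite /lebesgue_cons /pushforward preimage_bigcup.
apply: measure_semi_sigma_additive.
- by move=> i; rewrite -[X in measurable X]setTI; exact: mf.
- apply/trivIsetP => /= i j _ _ ij; rewrite -preimage_setI.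
  by move/trivIsetP : tG => /(_ _ _ _ _ ij) ->//; rewrite preimage_set0.
- by rewrite -preimage_bigcup -[X in measurable X]setTI; exact: mf.
Qed.

HB.instance Definition _ := isMeasure.Build _ _ _
  (lebesgue_cons mu) lebesgue_cons0 lebesgue_cons_ge0
  lebesgue_cons_sigma_additive.

Let lebesgue_cons_sigma_finite : sigma_finite setT (lebesgue_cons mu).
Proof.
have /sigma_finiteP[F [TF ndF Foo]] := sigma_finiteT (@lebesgue_measure R).
have /sigma_finiteP[G [TG ndG Goo]] := sigma_finiteT mu.
have [g [fK gK mg]] := rV_cons_bij n.
exists (fun k => g @^-1` (F k `*` G k)).
  rewrite -preimage_bigcup (_ : \bigcup_k _ = setT) ?preimage_setT//.
  rewrite -setXTT TF TG predeqE => -[x y]; split=> [[k _ []/= ? ?]|].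
    by split; exists k.
  move=> [/= [i _ Fix] [j _ Gjy]]; exists (maxn i j) => //; split.
  - by move: x Fix; exact/subsetPset/ndF/leq_maxl.
  - by move: y Gjy; exact/subsetPset/ndG/leq_maxr.
move=> k; have [mFk Fk] := Foo k; have [mGk Gk] := Goo k; split.
  rewrite -[X in measurable X]setTI; apply: mg => //.
  exact: (@measurableX _ _ R 'rV[R]_n).
rewrite /lebesgue_cons /pushforward -comp_preimage.
rewrite (_ : g \o _ = id); last by apply/funext => p; exact: gK.
by rewrite [ltLHS]product_measure1E// lte_mul_pinfty// ge0_fin_numE.
Qed.

HB.instance Definition _ := @Measure_isSigmaFinite.Build _ _ _
  (lebesgue_cons mu) lebesgue_cons_sigma_finite.
End lebesgue_cons_measure.

(* R^n.+1 is identified with R * R^n; lebesgue_rV_box below characterizes the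
   resulting measure *)
Fixpoint lebesgue_rV n : {sigma_finite_measure set 'rV[R]_n -> \bar R} :=
  match n with
  | 0 => \d_(0%R : 'rV[R]_0)
  | m.+1 => lebesgue_cons (lebesgue_rV m)
  end.

Lemma lebesgue_rV_box n (A : 'I_n -> set R) : (forall i, measurable (A i)) ->
  lebesgue_rV n [set v | forall i, A i (rV_coord i v)] =
  \prod_(i < n) lebesgue_measure (A i).
Proof.
elim: n A => [|n IH] A mA.
  rewrite big_ord0 /= diracE mem_set// => -[].
  by [].
have mB : measurable [set v : 'rV[R]_n |
    forall i, A (lift ord0 i) (rV_coord i v)].
  rewrite (_ : mkset _ =
      \bigcap_(i in [set: 'I_n]) (rV_coord i @^-1` A (lift ord0 i))).
    apply: fin_bigcap_measurable => // i _.
    by rewrite -[X in measurable X]setTI; exact: measurable_rV_coord.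
  by apply/seteqP; split => v h i; [move=> _|]; exact: h.
rewrite big_ord_recl -IH// /= /lebesgue_cons /pushforward.
rewrite -[RHS]product_measure1E//; last exact: mA.
congr (product_measure1 _ _ _).
apply/seteqP; split=> [[t v] h|[t v] [/= h h'] i].
  split; first by have := h ord0; rewrite rV_cons0.
  by move=> i; have := h (lift ord0 i); rewrite rV_consS.
case: (unliftP ord0 i) => [j|] ->; first by rewrite rV_consS; exact: h'.
by rewrite rV_cons0.
Qed.

End lebesgue_rV.

(* Complex Hilbert spaces; the inner product is linear on the left. *)
HB.mixin Record CompleteNormedModule_isHilbert (R : realType) K
    of CompleteNormedModule R[i] K := {
  hdot : K -> K -> R[i] ;
  hdotDl : forall x y z, hdot (x + y) z = hdot x z + hdot y z ;
  hdotZl : forall a x y, hdot (a *: x) y = a * hdot x y ;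
  hdotC : forall x y, hdot y x = (hdot x y)^* ;
  hdotxx : forall x : K, hdot x x = `|x| ^+ 2
}.

#[short(type="hilbertType")]
HB.structure Definition Hilbert (R : realType) :=
  { K of CompleteNormedModule_isHilbert R K & CompleteNormedModule R[i] K }.

Section hilbert.
Context {R : realType} {K : hilbertType R}.

(* the norm of K takes its values in R[i] *)
Definition hnorm (x : K) : R := complex.Re `|x|.

Definition separable_space (T : topologicalType) :=
  exists2 D : set T, countable D & dense D.

(* k = Some n stands for the finite dimension n, k = None for aleph_0 *)
Definition dim_index (k : option nat) : set nat :=
  [set i | if k is Some n then (i < n)%N else True].

Definition orthonormal_on (I : set nat) (e : nat -> K) :=
  forall i j, I i -> I j -> hdot (e i) (e j) = (i == j)%:R.

Definition span_on (I : set nat) (e : nat -> K) : set K :=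
  [set x | exists n (c : nat -> R[i]),
     x = \sum_(i < n | (i : nat) \in I) c i *: e i].

Definition hilbert_dim (k : option nat) :=
  exists e : nat -> K, orthonormal_on (dim_index k) e /\
    closure (span_on (dim_index k) e) = setT.
End hilbert.
Arguments hilbert_dim {R} K k.

Section cones.
Context {R : realType} {d : nat}.
Implicit Types P A : set 'rV[R]_d.

Definition convex_cone P :=
  [/\ P !=set0, convex_set P &
      forall (t : R) x, 0 <= t -> P x -> P (t *: x)].

Definition pointed_cone P := P `&` [set - x | x in P] = [set 0].

Definition spanning_cone P := [set x - y | x in P & y in P] = setT.

Definition P_module P A :=
  [/\ closed A, A <> setT, A 0 &
      forall x, P x -> [set a + x | a in A] `<=` A].
End cones.

(* Elements of L^2(A, K) are represented by functions on R^d, of which only the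
   restriction to A matters, and equality in L^2(A, K) is equality almost
   everywhere on A. *)
Section L2.
Context {R : realType} {d : nat} {K : hilbertType R}.
Variable A : set 'rV[R]_d.
Local Notation mu := (lebesgue_rV d).
Local Notation F := ('rV[R]_d -> K).
Implicit Types (f g : F) (T S : F -> F).

Definition L2norm f : \bar R :=
  sqrte (\int[mu]_(y in A) (hnorm (f y) ^+ 2)%:E)%E.

(* K carries its Borel sigma-algebra; since K will be separable, this is the
   usual (strong) measurability of K-valued functions *)
Definition L2 : set F :=
  [set f | measurable_fun A (f : _ -> g_sigma_algebraType (@open K)) /\
           (L2norm f < +oo)%E].

Definition L2dot f g : R[i] :=
  ((\int[mu]_(y in A) complex.Re (hdot (f y) (g y))) +i*
   (\int[mu]_(y in A) complex.Im (hdot (f y) (g y))))%C.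

Definition is_adjoint T S :=
  (forall g, L2 g -> L2 (S g)) /\
  (forall f g, L2 f -> L2 g -> L2dot (T f) g = L2dot f (S g)).

(* unique up to almost-everywhere equality on A; the identity is a dummy value
   for operators without adjoint *)
Definition adjoint T : F -> F := xget (id : F -> F) (is_adjoint T).

Definition shift_rep (x : 'rV[R]_d) : F -> F :=
  fun f y => if (y - x) \in A then f (y - x) else 0.

(* V and xi are only meaningful on P *)
Definition additive_cocycle (P : set 'rV[R]_d) (V : 'rV[R]_d -> F -> F)
    (xi : 'rV[R]_d -> F) :=
  [/\ forall x, P x -> L2 (xi x),
      forall x y, P x -> P y ->
        xi x \+ V x (xi y) = xi (x + y) %[ae mu in A],
      forall x, P x -> adjoint (V x) (xi x) = cst 0 %[ae mu in A] &
      forall x, P x ->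
        L2norm (xi y \- xi x) @[y --> within P (nbhs x)] --> 0%E].
End L2.

(* Main.v *)
(* Idea: [V_x^* xi_x = 0] says that [xi_x] vanishes on [A + x], and the cocycle
   identity then says that the densities [g_x = |xi_x|^2] glue, outside the sets
   [A + x], to one density on [A] that is invariant under translation by [P].
   Let [w] be an interior point of [P] and [E] a bounded part of [A].  The set
   [A \ (A + M w)] has mass at most [M] times the mass of [g_w], while, as
   [d >= 2], for [M = O(N)] it contains [N^2] disjoint translates of [E], all of
   the same mass.  Letting [N] tend to infinity, [E] has mass zero. *)
From HB Require Import structures.
Require Import Defs.
From mathcomp Require Import all_boot all_order all_algebra complex.
From mathcomp Require Import all_classical all_reals all_analysis.
From mathcomp Require Import measurable_realfun lra ring.
Set Implicit Arguments.
Unset Strict Implicit.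
Unset Printing Implicit Defensive.
Import Order.TTheory GRing.Theory Num.Theory.
Import numFieldNormedType.Exports.
Local Open Scope classical_set_scope.
Local Open Scope ring_scope.

(** * Translations and Borel sets of ['rV[R]_n] *)

Section rV_shift.
Context {R : realType}.

Lemma rV_coordD n (i : 'I_n) (v x : 'rV[R]_n) :
  rV_coord i (v + x) = rV_coord i v + rV_coord i x.
Proof. by rewrite /rV_coord mxE. Qed.

Lemma measurable_rV_shift n (x : 'rV[R]_n) :
  measurable_fun setT (fun v : 'rV[R]_n => v + x).
Proof.
apply: measurable_fun_rV => i.
rewrite (_ : _ \o _ = (fun v => rV_coord i v + rV_coord i x)); last first.
  by apply/funext => v; rewrite /= rV_coordD.
by apply: measurable_funD => //; exact: measurable_rV_coord.
Qed.

Lemma measurable_preimage_rV_shift n (x : 'rV[R]_n) (X : set 'rV[R]_n) :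
  measurable X -> measurable [set v | X (v + x)].
Proof.
by move=> mX; rewrite -[X in measurable X]setTI; exact: measurable_rV_shift.
Qed.

(** The pushforward by a translation preserves the length of every half-open interval, which
    determines Lebesgue measure. *)
Lemma lebesgue_measure_shift (a : R) (X : set R) : measurable X ->
  lebesgue_measure [set t | X (t + a)] = lebesgue_measure X.
Proof.
move=> mX.
have ma : measurable_fun setT (fun t : measurableTypeR R => t + a : measurableTypeR R).
  exact: measurable_funD.
apply/esym.
apply: (@lebesgue_measure_unique R (pushforward lebesgue_measure
  (fun t : measurableTypeR R => t + a : measurableTypeR R))) => //.
move=> _ [[b c]] _ <-.
rewrite /pushforward [RHS](_ : _ = lebesgue_measure `]b - a, c - a]).
  by rewrite !lebesgue_measure_itv/= !lte_fin ltrD2r -!EFinB opprB addrA subrK.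
congr lebesgue_measure; apply/seteqP; split=> t /=;
  by rewrite !in_itv/= ltrBlDr lerBrDr.
Qed.

(** Induction on [n]: a translation acts separately on the first coordinate and on the others, so it
    preserves the measure of rectangles, and uniqueness of the product measure concludes. *)
Lemma lebesgue_rV_shift n (x : 'rV[R]_n) (X : set 'rV[R]_n) : measurable X ->
  lebesgue_rV n [set v | X (v + x)] = lebesgue_rV n X.
Proof.
elim: n x X => [|n IH] x X mX.
  congr (lebesgue_rV 0 _); apply/funext => v /=.
  by congr X; apply/rowP => -[].
pose x0 := rV_coord ord0 x; pose x' := \row_j rV_coord (lift ord0 j) x.
pose tau (p : measurableTypeR R * 'rV[R]_n) : measurableTypeR R * 'rV[R]_n :=
  (p.1 + x0, p.2 + x').
have mtau : measurable_fun setT tau.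
  apply: measurable_fun_pair.
    exact: (@measurable_funD _ _ R setT fst (cst x0)).
  exact: measurableT_comp (measurable_rV_shift x') measurable_snd.
have tauE p : rV_cons p + x = rV_cons (tau p).
  apply/rowP => i; rewrite -!/(rV_coord _ _) rV_coordD.
  case: (unliftP ord0 i) => [j|] ->; last by rewrite !rV_cons0.
  by rewrite !rV_consS rV_coordD /= /rV_coord mxE.
rewrite /= /lebesgue_cons /pushforward.
have mY : measurable (@rV_cons R n @^-1` X).
  by rewrite -[X in measurable X]setTI; exact: measurable_rV_cons.
pose m := (@lebesgue_measure R \x lebesgue_rV n)%E.
have [m' m'E] : exists m' : {measure set (measurableTypeR R * 'rV[R]_n) -> \bar R},
    forall Y, m' Y = m (tau @^-1` Y).
  by unshelve eexists (pushforward m tau : {measure set _ -> \bar R}).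
have mE := @product_measure_unique _ _ (measurableTypeR R) 'rV[R]_n R
  (@lebesgue_measure R) (lebesgue_rV n) m' _ _ mY.
apply: etrans (esym (mE _)); last first.
  move=> B C mB mC; rewrite [LHS]m'E.
  rewrite (_ : _ @^-1` _ = [set t | B (t + x0)] `*` [set v | C (v + x')]);
    last by apply/seteqP; split => -[].
  rewrite [LHS]product_measure1E//.
  - by congr (_ * _)%E; [exact: lebesgue_measure_shift|exact: IH].
  - have := @measurable_funD _ _ R setT id (cst x0) => /(_ _ _)/(_ measurableT B mB).
    by rewrite setTI; apply.
  - exact: measurable_preimage_rV_shift.
rewrite m'E; congr (m _).
by apply/funext => p /=; rewrite tauE.
Qed.

(** An open set is the union of the countably many boxes with rational corners that it contains. *)
Lemma open_measurable_rV n (U : set 'rV[R]_n) : open U -> measurable U.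
Proof.
move=> oU.
pose B (p : 'rV[rat]_n * 'rV[rat]_n) : set 'rV[R]_n :=
  [set v | forall i, ratr (p.1 ord0 i) < rV_coord i v < ratr (p.2 ord0 i)].
have mB p : measurable (B p).
  rewrite (_ : B p = \bigcap_(i in [set: 'I_n])
      (rV_coord i @^-1` `]ratr (p.1 ord0 i), ratr (p.2 ord0 i)[)).
    apply: fin_bigcap_measurable => // i _.
    by rewrite -[X in measurable X]setTI; exact: measurable_rV_coord.
  apply/seteqP; split => v h i; last by have := h i I; rewrite /= in_itv.
  by move=> _ /=; rewrite in_itv/=; exact: h.
rewrite (_ : U = \bigcup_(p in [set p | B p `<=` U]) B p).
  rewrite bigcup_mkcond; apply: countable_bigcupT_measurable => // p.
  by case: ifPn.
apply/seteqP; split => [v Uv|v [p /=]]; last exact.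
(* Neighbourhoods of a matrix are entrywise: [W] gives one for each coordinate. *)
have [W nW WU] : nbhs v U by exact: open_nbhs_nbhs.
have /choice[a aP] i : exists q : rat * rat,
    ratr q.1 < v ord0 i < ratr q.2 /\
    forall t, ratr q.1 < t < ratr q.2 -> W ord0 i t.
  have /nbhs_ballP[e /= e0 eW] := nW ord0 i.
  have /rat_in_itvoo[q] : v ord0 i - e < v ord0 i by rewrite gtrBl.
  rewrite in_itv/= => /andP[q1 q2].
  have /rat_in_itvoo[q'] : v ord0 i < v ord0 i + e by rewrite ltrDl.
  rewrite in_itv/= => /andP[q'1 q'2].
  exists (q, q'); split => /=; first by rewrite q2 q'1.
  move=> t /andP[t1 t2]; apply: eW; rewrite /ball/= ltr_distlC.
  by rewrite (lt_trans q1 t1) (lt_trans t2 q'2).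
exists (\row_i (a i).1, \row_i (a i).2); last first.
  by move=> i; rewrite !mxE; exact: (aP i).1.
move=> w Bw; apply: WU => i j; rewrite (ord1 i).
by apply: (aP j).2; have := Bw j; rewrite !mxE.
Qed.

Lemma closed_measurable_rV n (C : set 'rV[R]_n) : closed C -> measurable C.
Proof.
move=> cC; rewrite -(setCK C); apply: measurableC.
by apply: open_measurable_rV; exact: closed_openC.
Qed.

End rV_shift.

(** * Integrals of functions not known to be measurable *)

(* The adjoint of [shift_rep] is tested against functions whose inner products
   are not known to be measurable, hence no measurability of the integrand. *)
Section integral_nonmeasurable.
Local Open Scope ereal_scope.
Context d (T : measurableType d) (R : realType).
Variable mu : {measure set T -> \bar R}.

Import HBNNSimple.

(** The integral of a nonnegative function, unfolded; [integral] is the difference of its values at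
    the positive and negative parts. *)
Let nnint (f : T -> \bar R) := ereal_sup [set sintegral mu h |
  h in [set h : {nnsfun T >-> R} | forall x, (h x)%:E <= f x]].

(** Any nonzero level set of a simple function below [f] lies in the null set off which [f]
    vanishes. *)
Lemma nnint_ae0 (f : T -> \bar R) : (forall x, 0 <= f x) ->
  (\forall x \ae mu, f x = 0) -> nnint f = 0.
Proof.
move=> f0 [N [mN N0 fN]]; apply/eqP; rewrite eq_le; apply/andP; split.
  apply: ge_ereal_sup => _ [h /= hf <-].
  rewrite sintegralET fsbig1// => r _.
  have [->|r0] := eqVneq r 0%R; first by rewrite mul0e.
  rewrite (_ : mu _ = 0) ?mule0//.
  apply: (subset_measure0 _ mN _ N0) => // z /= hz; apply: fN => /= fz.
  move: (hf z); rewrite fz hz lee_fin => r_le0.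
  move/eqP: r0; apply; apply/eqP; rewrite eq_le r_le0/= -hz.
  exact: fun_ge0.
apply: ereal_sup_ubound; exists nnsfun0 => //=; exact: sintegral0.
Qed.

(** Composing with [phi] turns a simple function below [f] into one below [f \o phi] whose level
    sets have the same measure. *)
Lemma nnint_le_comp (phi : T -> T) (f : T -> \bar R) :
  measurable_fun setT phi ->
  (forall X, measurable X -> mu (phi @^-1` X) = mu X) ->
  nnint f <= nnint (f \o phi).
Proof.
move=> mphi muphi; apply: ge_ereal_sup => _ [h /= hf <-].
pose g := h \o phi.
have mg : measurable_fun setT g by exact: measurableT_comp.
have fg : finite_set (range g).
  apply: sub_finite_set (@fimfunP _ _ h) => _ [x _ <-]; exists (phi x) => //.
have g0 x : (0 <= g x)%R by exact: fun_ge0.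
pose gM := isMeasurableFun.Build _ _ _ _ _ mg.
pose gF := FiniteImage.Build _ _ _ fg.
pose gN := isNonNegFun.Build _ _ _ g0.
pose g' : {nnsfun T >-> R} := HB.pack g gM gF gN.
apply: ereal_sup_ubound; exists g' => /=; first by move=> x; exact: hf.
rewrite !sintegralET; apply: eq_fsbigr => r _; congr (_ * _).
by rewrite /g' /= /g comp_preimage muphi.
Qed.

Lemma integral_ae0 (D : set T) (f : T -> \bar R) :
  f = cst 0 %[ae mu in D] -> \int[mu]_(x in D) f x = 0.
Proof.
move=> f0; have fD : \forall x \ae mu, (f \_ D) x = 0.
  by apply: filterS f0 => x /= f0; rewrite patchE; case: ifPn => // /set_mem/f0.
rewrite /integral -!/(nnint _) !nnint_ae0 ?sube0//.
- by apply: filterS fD => x; rewrite funenegE => ->; rewrite oppe0 maxxx.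
- by apply: filterS fD => x; rewrite funeposE => ->; rewrite maxxx.
Qed.

(** The inverse [psi] preserves the measure too, so [nnint_le_comp] applies in both directions. *)
Lemma integral_preimage (phi psi : T -> T) (D : set T) (f : T -> \bar R) :
  measurable_fun setT phi -> measurable_fun setT psi ->
  cancel phi psi -> cancel psi phi ->
  (forall X, measurable X -> mu (phi @^-1` X) = mu X) ->
  \int[mu]_(x in phi @^-1` D) f (phi x) = \int[mu]_(x in D) f x.
Proof.
move=> mphi mpsi phiK psiK muphi.
have mupsi X : measurable X -> mu (psi @^-1` X) = mu X.
  move=> mX; rewrite -muphi; last by rewrite -[X in measurable X]setTI; exact: mpsi.
  by rewrite -comp_preimage (_ : psi \o phi = id)//; apply/funext.
have nnintE g : nnint (g \o phi) = nnint g.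
  apply/eqP; rewrite eq_le nnint_le_comp// andbT.
  rewrite [leRHS](_ : _ = nnint ((g \o phi) \o psi)) ?nnint_le_comp//.
  by congr nnint; apply/funext => x /=; rewrite psiK.
rewrite /integral -!/(nnint _).
rewrite -[in RHS]nnintE -[X in _ = _ - X]nnintE.
by congr (nnint _ - nnint _); apply/funext => x;
  rewrite /= ?funeposE ?funenegE !patchE /=.
Qed.

End integral_nonmeasurable.

Section rV_shift_integral.
Context {R : realType} {n : nat}.
Local Notation mu := (@lebesgue_rV R n).

Lemma integral_rV_shift (x : 'rV[R]_n) (D : set 'rV[R]_n) (f : 'rV[R]_n -> \bar R) :
  (\int[mu]_(v in [set v | D (v + x)%R]) f (v + x)%R = \int[mu]_(v in D) f v)%E.
Proof.
apply: (@integral_preimage _ _ _ mu (fun v => v + x) (fun v => v - x)).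
- exact: measurable_rV_shift.
- exact: measurable_rV_shift.
- by move=> v; rewrite addrK.
- by move=> v; rewrite subrK.
- exact: lebesgue_rV_shift.
Qed.

Lemma ae_rV_shift (x : 'rV[R]_n) (Q : 'rV[R]_n -> Prop) :
  (\forall v \ae mu, Q v) -> \forall v \ae mu, Q (v + x).
Proof.
move=> [N [mN N0 QN]]; exists [set v | N (v + x)]; split.
- exact: measurable_preimage_rV_shift.
- by rewrite lebesgue_rV_shift.
- by move=> v /= Qv; exact: QN.
Qed.

End rV_shift_integral.

(** * Convex cones and order units *)

Section cones.
Context {R : realType} {d : nat}.
Implicit Types P : set 'rV[R]_d.

(** [x + y] is twice the midpoint of [x] and [y]. *)
Lemma convex_coneD P x y : convex_cone P -> P x -> P y -> P (x + y).
Proof.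
move=> [_ cvxP coneP] Px Py.
have h0 : 0 <= 2^-1 :> R by rewrite invr_ge0.
have h1 : 2^-1 <= 1 :> R by rewrite invf_le1// ler1n.
have := cvxP x y (Itv01 h0 h1); rewrite !inE => /(_ Px Py).
move=> /(coneP 2 _ (ler0n _ _)).
congr P; apply/rowP => i; rewrite !mxE /unstable.onem /=.
by field.
Qed.

Lemma convex_cone_sum P (I : Type) (r : seq I) (F : I -> 'rV[R]_d) :
  convex_cone P -> (forall i, P (F i)) -> P (\sum_(i <- r) F i).
Proof.
move=> cP PF; elim/big_ind: _ => // [|x y]; last exact: convex_coneD.
by have [[x Px] _ /(_ 0 x (lexx _) Px)] := cP; rewrite scale0r.
Qed.

(* Writing [delta_i = x_i - y_i] with [x_i, y_i] in [P], the sum of all the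
   [x_i + y_i] works. *)
Lemma spanning_cone_order_unit P : convex_cone P -> spanning_cone P ->
  exists u : 'rV[R]_d, forall (t : R) (z : 'rV[R]_d),
    (forall i, `|z ord0 i| <= t) -> P (t *: u - z).
Proof.
move=> cP sP.
have /choice[xy xyP] (i : 'I_d) : exists p : 'rV[R]_d * 'rV[R]_d,
    [/\ P p.1, P p.2 & p.1 - p.2 = delta_mx ord0 i].
  have : [set x - y | x in P & y in P] (delta_mx ord0 i) by rewrite sP.
  by move=> [x Px [y Py xy]]; exists (x, y).
exists (\sum_i ((xy i).1 + (xy i).2)) => t z zt.
have -> : t *: (\sum_i ((xy i).1 + (xy i).2)) - z =
    \sum_i ((t - z ord0 i) *: (xy i).1 + (t + z ord0 i) *: (xy i).2).
  rewrite {1}(row_sum_delta z) scaler_sumr -sumrB; apply: eq_bigr => i _.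
  have [_ _ <-] := xyP i.
  by apply/rowP => j; rewrite !mxE; ring.
apply: convex_cone_sum => // i; have [P1 P2 _] := xyP i.
have [_ _ cone] := cP.
have := zt i; rewrite ler_norml => /andP[z1 z2].
by apply: convex_coneD => //; apply: cone => //; lra.
Qed.

(** Were [u] zero, [P] would contain every vector. The nonzero coordinate will separate translates
    along [u]. *)
Lemma pointed_cone_order_unit_neq0 P (u : 'rV[R]_d) : (0 < d)%N ->
  pointed_cone P ->
  (forall (t : R) (z : 'rV[R]_d), (forall i, `|z ord0 i| <= t) -> P (t *: u - z)) ->
  exists k, u ord0 k != 0.
Proof.
move=> d0 pP uP; apply: contrapT => /forallNP u0.
have {}u0 : u = 0.
  by apply/rowP => k; rewrite mxE; apply/eqP/negPn/negP; exact: u0.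
pose z : 'rV[R]_d := const_mx 1.
have Pz : P z.
  have := uP 1 (- z); rewrite u0 scaler0 sub0r opprK; apply => i.
  by rewrite !mxE normrN normr1.
have PNz : P (- z).
  by have := uP 1 z; rewrite u0 scaler0 sub0r; apply => i; rewrite !mxE normr1.
have : (P `&` [set - x | x in P]) z by split => //; exists (- z); rewrite ?opprK.
rewrite pP /= => /rowP/(_ (Ordinal d0)); rewrite !mxE => /eqP.
by rewrite oner_eq0.
Qed.

End cones.

(** * Growth and spacing of natural numbers *)

Section real_facts.
Context {R : realType}.

Lemma exists_nat_gt (x : R) : exists n : nat, x < n%:R.
Proof.
by exists (Num.bound `|x|); exact: le_lt_trans (ler_norm _) (archi_boundP _).
Qed.

Lemma quadratic_le_linear_eq0 (I C : R) (m : nat) : 0 <= I -> 0 <= C ->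
  (forall N : nat, (N * N)%:R * I <= (m + 3 * N)%:R * C) -> I = 0.
Proof.
move=> I0 C0 h; apply/eqP; rewrite eq_le I0 andbT leNgt; apply/negP => Igt0.
(* This [N] gives [(m + 3) * C < N * I]; the hypothesis is then contradicted at [N.+1], where
   [m + 3 * N.+1 <= N.+1 * (m + 3)]. *)
have [N] := exists_nat_gt ((m%:R + 3) * C / I).
rewrite ltr_pdivrMr// => NI.
have := h N.+1; rewrite natrM natrD natrM -(natr1 N).
set M := N%:R; set m' := m%:R => hN.
have M0 : 0 <= M by exact: ler0n.
have m0 : 0 <= m' by exact: ler0n.
have : (m' + 3 * (M + 1)) * C <= (M + 1) * ((m' + 3) * C).
  by rewrite -subr_ge0 (_ : _ - _ = M * m' * C); [rewrite !mulr_ge0|ring].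
have : (M + 1) * ((m' + 3) * C) < (M + 1) * ((M + 1) * I).
  rewrite ltr_pM2l; last by rewrite ltr_wpDl.
  by apply: lt_trans NI _; rewrite ltr_pM2r// ltrDl.
move=> h1 h2; have := le_trans hN h2.
by rewrite leNgt (lt_le_trans h1)// mulrA.
Qed.

(** In use, [a] is the spacing of a grid of translates and [b] the width of the translated box. *)
Lemma natr_dist_lt1 (i j : nat) (a b : R) : 0 < a -> b < a ->
  `|i%:R - j%:R| * a <= b -> i = j.
Proof.
move=> a0 ba h; apply/eqP; rewrite eqn_leq; apply/andP.
have : `|i%:R - j%:R| < 1 :> R.
  by rewrite -(ltr_pM2r a0) mul1r (le_lt_trans h).
rewrite ltr_norml => /andP[ij ji].
by split; rewrite -ltnS -(ltr_nat R) -natr1; lra.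
Qed.

End real_facts.

(** * Invariant densities and the counting argument *)

(* [G x] stands for [|xi_x|^2], extended by zero outside [A]. *)
Section density.
Context {R : realType} {d : nat} (P A : set 'rV[R]_d).
Local Notation mu := (@lebesgue_rV R d).
Context (G : 'rV[R]_d -> 'rV[R]_d -> \bar R).
Hypothesis cP : convex_cone P.
Hypothesis mA : measurable A.
Hypothesis PA : forall a x, P x -> A a -> A (a + x).
Hypothesis G0 : forall x z, (0 <= G x z)%E.
Hypothesis mG : forall x, P x -> measurable_fun setT (G x).
(** The cocycle identity for densities: [xi_x] vanishes on [A + x] and [V_x xi_y] off it, so at most
    one summand survives at each point. *)
Hypothesis GD : forall x y, P x -> P y ->
  \forall z \ae mu, G (x + y) z = if z - x \in A then G y (z - x) else G x z.

Lemma measurable_density_shift (x y : 'rV[R]_d) : P y ->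
  measurable_fun setT (fun z : 'rV[R]_d => G y (z - x)).
Proof. by move=> Py; exact: measurableT_comp (mG Py) (measurable_rV_shift (- x)). Qed.

(** By [GD], almost everywhere [G (x + y) z] is one of the nonnegative terms [G x z] and
    [G y (z - x)]. *)
Lemma integral_density_leD x y : P x -> P y ->
  (\int[mu]_z G (x + y)%R z <= \int[mu]_z G x z + \int[mu]_z G y z)%E.
Proof.
move=> Px Py; have Pxy := convex_coneD cP Px Py.
have -> : (\int[mu]_z G y z = \int[mu]_z G y (z - x)%R)%E.
  exact: esym (integral_rV_shift (- x) setT (G y)).
rewrite -ge0_integralD//; [|exact: mG|exact: measurable_density_shift].
apply: ae_ge0_le_integral => //.
- exact: mG.
- by move=> z _; exact: adde_ge0.
- by apply: emeasurable_funD; [exact: mG|exact: measurable_density_shift].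
apply: filterS (GD Px Py) => z -> _; case: ifPn => _.
  exact: leeDr.
exact: leeDl.
Qed.

(** Linear growth of the total mass along a ray: the upper bound of the counting argument. *)
Lemma integral_density_leMn x n : P x ->
  (\int[mu]_z G (n.+1%:R *: x)%R z <= n.+1%:R%:E * \int[mu]_z G x z)%E.
Proof.
move=> Px; elim: n => [|n IH]; first by rewrite scale1r mul1e.
rewrite -[X in (X *: x)%R]natr1 scalerDl scale1r.
apply: le_trans (integral_density_leD _ Px) _.
  by have [_ _] := cP; apply.
rewrite -[X in (_ <= X%:E * _)%E]natr1 EFinD ge0_muleDl ?lee_fin// mul1e.
exact: leeD.
Qed.

(** The gluing: off [A + w], the density no longer changes when an element of [P] is added to
    [w]. *)
Lemma integral_density_stable (E : set 'rV[R]_d) w w' : measurable E ->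
  P w -> P w' -> (forall z, E z -> ~ A (z - w)) ->
  (\int[mu]_(z in E) G (w + w')%R z = \int[mu]_(z in E) G w z)%E.
Proof.
move=> mE Pw Pw' EA; apply: ge0_ae_eq_integral => //.
- by apply: (measurable_funS measurableT) => //; apply: mG; exact: convex_coneD.
- by apply: (measurable_funS measurableT) => //; exact: mG.
apply: filterS (GD Pw Pw') => z -> Ez.
by rewrite memNset//; exact: EA.
Qed.

(** At a point [z] of [E + p], expand [G (w + p)] in both orders: one gives [G w z] since [z] is off
    [A + w], the other [G w (z - p)] since [z - p] is in [A]. *)
Lemma integral_density_shift (E : set 'rV[R]_d) w p : measurable E ->
  E `<=` A -> P w -> P p -> (forall z, E z -> ~ A (z + p - w)) ->
  (\int[mu]_(z in [set z | E (z - p)%R]) G w z = \int[mu]_(z in E) G w z)%E.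
Proof.
move=> mE EA Pw Pp EwA; rewrite -[RHS](integral_rV_shift (- p)).
have mEp := measurable_preimage_rV_shift (- p) mE.
apply: ge0_ae_eq_integral => //.
- by apply: (measurable_funS measurableT) => //; exact: mG.
- by apply: (measurable_funS measurableT) => //; exact: measurable_density_shift.
apply: filterS2 (GD Pw Pp) (GD Pp Pw) => z wp pw /= Ez.
move: wp; rewrite addrC pw (mem_set (EA _ Ez)) memNset => [<-//|].
by have := EwA _ Ez; rewrite subrK.
Qed.

(** The translates [E + p i] are disjoint and all carry the mass of [E]. *)
Lemma integral_density_packing (I : finType) (E : set 'rV[R]_d) w
    (p : I -> 'rV[R]_d) : measurable E -> E `<=` A -> P w ->
  (forall i, P (p i)) -> (forall i z, E z -> ~ A (z + p i - w)) ->
  (forall i j z, E (z - p i) -> E (z - p j) -> i = j) ->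
  (#|I|%:R%:E * \int[mu]_(z in E) G w z <= \int[mu]_z G w z)%E.
Proof.
move=> mE EA Pw Pp EwA Einj.
pose F i := [set z | E (z - p i)].
have mF i : measurable (F i) by exact: measurable_preimage_rV_shift.
apply: (@le_trans _ _ (\int[mu]_(z in \big[setU/set0]_(i <- enum I) F i) G w z)%E);
    last first.
  apply: ge0_subset_integral => //; last exact: mG.
  exact: bigsetU_measurable.
rewrite ge0_integral_bigsetU//; last 3 first.
- exact: enum_uniq.
- apply/trivIsetP => i j _ _ ij; apply/seteqP; split => // z [/= Ei Ej].
  by move/eqP : ij; apply; exact: Einj Ei Ej.
- by apply: (measurable_funS measurableT) => //; exact: mG.
rewrite big_enum /= (eq_bigr (fun=> \int[mu]_(z in E) G w z)%E); last first.
  by move=> i _; apply: integral_density_shift => // z Ez; exact: EwA.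
by rewrite sumr_const mule_natl.
Qed.


Hypothesis d_ge2 : (2 <= d)%N.
Hypothesis pP : pointed_cone P.
Hypothesis sP : spanning_cone P.
Hypothesis AnT : A <> setT.
Hypothesis Gfin : forall x, P x -> (\int[mu]_z G x z < +oo)%E.

Lemma density_box_eq0 (r : nat) :
  let E := A `&` [set z : 'rV[R]_d | forall i, `|z ord0 i| <= r%:R] in
  measurable E ->
  exists w, [/\ P w, forall z, E z -> ~ A (z - w) & (\int[mu]_(z in E) G w z = 0)%E].
Proof.
move=> E mE; have [_ _ coneP] := cP.
have [u uP] := spanning_cone_order_unit cP sP.
have [k uk] := pointed_cone_order_unit_neq0 (ltnW d_ge2) pP uP.
(* Here [d >= 2] enters: coordinate [l] provides a direction independent of [u]. *)
have [l lk] : exists l, l != k.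
  have [k0|k0] := eqVneq (k : nat) 0%N.
    by exists (Ordinal d_ge2); rewrite -val_eqE /= k0.
  by exists (Ordinal (ltnW d_ge2)); rewrite -val_eqE /= eq_sym.
have uk0 : 0 < `|u ord0 k| by rewrite normr_gt0.
have r0 : 0 <= r%:R :> R by exact: ler0n.
(* With this scale, one step of [w] in coordinate [k] and one step of [e] in coordinate [l] both
   exceed the width [2 * r] of the box. *)
have [s sgt] := exists_nat_gt (2 * r%:R / `|u ord0 k| + 2 * r%:R).
have rs : 2 * r%:R < s%:R :> R.
  by apply: le_lt_trans sgt; rewrite lerDr divr_ge0 ?mulr_ge0.
have rsu : 2 * r%:R < s%:R * `|u ord0 k|.
  by rewrite -ltr_pdivrMr//; apply: le_lt_trans sgt; rewrite lerDl mulr_ge0.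
have s0 : 0 < s%:R :> R by apply: le_lt_trans rs; rewrite mulr_ge0.
have s1 : 1 <= s%:R :> R by rewrite ler1n -(ltr_nat R).
pose w := s%:R *: u; pose e : 'rV[R]_d := s%:R *: delta_mx ord0 l.
(* [P] contains a two-dimensional sector around [w], where the [N * N] translations will be
   found. *)
have wP (t a : R) : `|a| <= t -> P (t *: w + a *: e).
  move=> at0; rewrite (_ : _ + _ = (t * s%:R) *: u - (- (a * s%:R)) *: delta_mx ord0 l).
    apply: uP => i; rewrite !mxE /= normrM normrN normrM (ger0_norm (ltW s0)).
    rewrite -[leRHS]mulr1 ler_pM// ?mulr_ge0//.
      by rewrite ler_wpM2r// ltW.
    by case: (_ == _); rewrite ?normr1 ?normr0.
  by rewrite scaleNr opprK !scalerA.
have Pw : P w by have := wP 1 0; rewrite normr0 scale1r scale0r addr0; exact.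
have [p Ap] : exists p, ~ A p.
  by apply: contrapT => /forallNP h; apply: AnT; apply/seteqP; split => // z _;
    apply: contrapT; exact: h.
have [b pb] := exists_nat_gt (\sum_i `|p ord0 i|).
have {}pb i : `|p ord0 i| <= b%:R.
  apply: le_trans (ltW pb); rewrite (bigD1 i)//= lerDl.
  by apply: sumr_ge0.
pose m := (r + b)%N.
(* Otherwise adding an element of [P] would bring [p] into [A]: the coordinates of [z - p] are at
   most [r + b = m], so a large multiple of [u] dominates it. *)
have EmA z : E z -> ~ A (z - m.+1%:R *: w).
  move=> [_ zr] zA; apply: Ap.
  rewrite (_ : p = z - m.+1%:R *: w + ((m.+1%:R * s%:R) *: u - (z - p))); last first.
    by rewrite -scalerA -/w; apply/rowP => i; rewrite !mxE; ring.
  apply: PA zA; apply: uP => i; rewrite !mxE.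
  apply: (le_trans (ler_normB _ _)); apply: (le_trans (lerD (zr i) (pb i))).
  by rewrite -natrD -[leLHS]mulr1 ler_pM// ler_nat.
exists (m.+1%:R *: w); split => //; first exact: coneP.
have GE0 v : (0 <= \int[mu]_(z in E) G v z)%E by exact: integral_ge0.
have GT0 v : (0 <= \int[mu]_z G v z)%E by exact: integral_ge0.
have Pm n : P (n%:R *: w) by exact: coneP.
have finT v : P v -> (\int[mu]_z G v z)%E \is a fin_num.
  by move=> Pv; rewrite ge0_fin_numE ?Gfin.
have finE v : P v -> (\int[mu]_(z in E) G v z)%E \is a fin_num.
  move=> Pv; rewrite ge0_fin_numE//; apply: le_lt_trans (Gfin Pv).
  by apply: ge0_subset_integral => //; exact: mG.
rewrite -(fineK (finE _ (Pm m.+1))); congr EFin.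
apply: (@quadratic_le_linear_eq0 R _ (fine (\int[mu]_z G w z)) m.+1).
- exact: fine_ge0.
- exact: fine_ge0.
move=> N; rewrite -lee_fin !EFinM !fineK ?finE ?finT//.
(* The first coefficient is at least [N] so that [q ij] lies in [P]. *)
pose q (ij : 'I_N * 'I_N) := (N + ij.2)%:R *: w + ij.1%:R *: e.
(* Replacing [m.+1] by [m.+1 + 3 * N] makes room for the translates and, by stability, keeps the
   mass of [E]. *)
have /= := @integral_density_packing ('I_N * 'I_N)%type E ((m.+1 + 3 * N)%:R *: w) q.
rewrite card_prod card_ord natrD scalerDl integral_density_stable//.
move=> pack; apply: (le_trans (pack _ _ _ _ _ _)) => //.
- by move=> z [].
- by rewrite -scalerDl -natrD.
- move=> [i j]; apply: wP; rewrite normr_nat ler_nat.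
  exact/ltnW/ltn_addr.
(* Adding [(2N - j) w - i e], which lies in [P] as [i <= N <= 2N - j], would bring [z - m.+1 w] into
   [A]; here [3N = (N + j) + (2N - j)]. *)
- move=> [i j] z Ez; rewrite /q /= => h; apply: (EmA _ Ez).
  have hij : (i%:R : R) <= 2 * N%:R - j%:R.
    have : (i%:R : R) <= N%:R by rewrite ler_nat ltnW.
    have : (j%:R : R) <= N%:R by rewrite ler_nat ltnW.
    lra.
  have := PA (wP (2 * N%:R - j%:R) (- i%:R) _) h; rewrite normrN normr_nat => /(_ hij).
  by congr A; apply/rowP => x; rewrite !mxE natrM natrD; ring.
(* Coordinate [k] of [q (i, j)] does not involve [i], so it forces [j = j']; coordinate [l] then
   forces [i = i']. *)
- move=> [i j] [i' j'] z [_ h] [_ h'].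
  have hd x : `|(z - q (i, j)) ord0 x - (z - q (i', j')) ord0 x| <= 2 * r%:R.
    by apply: (le_trans (ler_normB _ _)); have := h x; have := h' x; lra.
  have jj : j = j'.
    apply/val_inj/(natr_dist_lt1 (mulr_gt0 s0 uk0) rsu).
    have := hd k; rewrite !mxE eqxx /= (eq_sym k) (negbTE lk) /= !natrD distrC.
    have -> : s%:R * `|u ord0 k| = `|s%:R * u ord0 k| by rewrite normrM normr_nat.
    by rewrite -normrM; congr (`|_| <= _); ring.
  congr pair => //; apply/val_inj/(natr_dist_lt1 s0 rs).
  have := hd l; rewrite !mxE /= !eqxx jj distrC.
  rewrite -[X in _ * X <= _](normr_nat R s) -normrM.
  by congr (`|_| <= _); rewrite !natrD mulr1n; ring.
rewrite -scalerDl -natrD addSn.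
exact: integral_density_leMn.
Qed.

(** Countably many boxes exhaust the space, so it is enough to pass from the [w] of each box to the
    given [x]. *)
Lemma density_ae_eq0 x : P x ->
  \forall z \ae mu, A z -> ~ A (z - x) -> G x z = 0%E.
Proof.
move=> Px.
have : forall r : nat, \forall z \ae mu,
    (forall i, `|(z : 'rV[R]_d) ord0 i| <= r%:R) -> A z -> ~ A (z - x) -> G x z = 0%E.
  move=> r.
  have mE : measurable (A `&` [set z : 'rV[R]_d | forall i, `|z ord0 i| <= r%:R]).
    apply: measurableI => //.
    rewrite (_ : mkset _ = \bigcap_(i in [set: 'I_d])
        (rV_coord i @^-1` `[- r%:R, r%:R])).
      apply: fin_bigcap_measurable => // i _.
      by rewrite -[X in measurable X]setTI; exact: measurable_rV_coord.
    apply/seteqP; split => z h i.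
      by move=> _ /=; rewrite in_itv /= -ler_norml; exact: h.
    by have := h i I; rewrite /= in_itv /= -ler_norml.
  have [w [Pw EwA Gw0]] := density_box_eq0 mE.
  have Gwae : ae_eq mu (A `&` [set z : 'rV[R]_d | forall i, `|z ord0 i| <= r%:R]) (G w) (cst 0%E).
    apply/ae_eq_integral_abs => //.
      by apply: (measurable_funS measurableT) => //; exact: mG.
    by rewrite -[RHS]Gw0; apply: eq_integral => z _; rewrite gee0_abs.
  (* Off both [A + x] and [A + w], the two expansions of [G (x + w)] give [G x z = G w z]. *)
  apply: filterS3 Gwae (GD Px Pw) (GD Pw Px) => z Gz xw wx zr Az zx.
  move: xw; rewrite addrC wx memNset; last exact: EwA.
  by rewrite memNset// => <-; exact: Gz.
move=> /ae_foralln; apply: filterS => z h.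
have [r zr] := exists_nat_gt (\sum_i `|z ord0 i|).
apply: (h r) => i; apply: le_trans (ltW zr).
by rewrite (bigD1 i)//= lerDl sumr_ge0.
Qed.

End density.

(** * The real-valued norm of a Hilbert space *)

Section hilbert.
Context {R : realType} {K : hilbertType R}.
Implicit Types x y : K.

(** A nonnegative element of [R[i]] has zero imaginary part. *)
Lemma normr_hnorm x : `|x| = (hnorm x)%:C%C.
Proof.
have : 0 <= `|x| by exact: normr_ge0.
by rewrite /hnorm; case: `|x| => a b /ger0_Im /= ->.
Qed.

Lemma hnorm_eq0 x : hnorm x = 0 -> x = 0.
Proof. by move=> x0; apply/normr0_eq0; rewrite normr_hnorm x0. Qed.

Lemma hdot0l y : hdot (0 : K) y = 0.
Proof. by rewrite -(scale0r (0 : K)) hdotZl mul0r. Qed.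

Lemma hdot0r x : hdot x (0 : K) = 0.
Proof. by rewrite hdotC hdot0l rmorph0. Qed.

Lemma Re_hdotxx x : complex.Re (hdot x x) = hnorm x ^+ 2.
Proof. by rewrite hdotxx normr_hnorm -rmorphXn. Qed.

Lemma hnorm_dist x y : `|hnorm x - hnorm y| <= hnorm (x - y).
Proof.
have := ler_dist_dist x y; rewrite !normr_hnorm -rmorphB /=.
by rewrite normc_def /= expr0n /= addr0 sqrtr_sqr lecR.
Qed.

Lemma hnorm_continuous : continuous (@hnorm R K).
Proof.
move=> x; apply/cvgrPdist_lt => e e0.
have e0' : 0 < e%:C%C by rewrite ltcR.
apply/nbhs_ballP; exists e%:C%C => //= y.
rewrite -ball_normE /= normr_hnorm ltcR; apply: le_lt_trans.
exact: hnorm_dist.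
Qed.

Lemma measurable_hnorm2 d (T : measurableType d) (D : set T) (f : T -> K) :
  measurable_fun D (f : T -> g_sigma_algebraType (@open K)) ->
  measurable_fun D (fun t => (hnorm (f t) ^+ 2)%:E).
Proof.
move=> mf; apply/measurable_EFinP; apply: measurable_funX.
have mh : measurable_fun setT (@hnorm R K : g_sigma_algebraType (@open K) -> R).
  move=> mT; apply: (measurability _ (RGenOpens.measurableE R)) => //.
  move=> _ [_ [a [b ->] <-]]; rewrite setTI; apply: sub_sigma_algebra.
  by move/continuousP : hnorm_continuous; apply; exact: interval_open.
exact: (measurableT_comp mh mf).
Qed.

End hilbert.

(** * The adjoint of a translation isometry *)

Section shift_rep_adjoint.
Context {R : realType} {d : nat} {K : hilbertType R}.
Context (A : set 'rV[R]_d) (x : 'rV[R]_d).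
Hypothesis mA : measurable A.
Hypothesis Ax : forall a, A a -> A (a + x).
Local Notation mu := (@lebesgue_rV R d).

Lemma L2norm_fin (f : 'rV[R]_d -> K) : (L2norm A f < +oo)%E ->
  (\int[mu]_(y in A) (hnorm (f y) ^+ 2)%:E < +oo)%E.
Proof.
have i0 : (0 <= \int[mu]_(y in A) (hnorm (f y) ^+ 2)%:E)%E.
  by apply: integral_ge0 => y _; rewrite lee_fin sqr_ge0.
by rewrite /L2norm -!ge0_fin_numE ?sqrte_ge0// sqrte_fin_num.
Qed.

Lemma measurable_fun_shift d' (T : measurableType d') (f : 'rV[R]_d -> T) :
  measurable_fun A f ->
  measurable_fun [set v | A (v + x)] (fun v => f (v + x)).
Proof.
move=> mf _ Y mY.
exact: (measurable_preimage_rV_shift x (mf mA Y mY)).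
Qed.

(** [A] is contained in [A - x], and over [A - x] the translated function has the square integral of
    [f] over [A]. *)
Lemma L2_shift (f : 'rV[R]_d -> K) : L2 A f -> L2 A (fun v => f (v + x)).
Proof.
move=> [mf foo]; have msh := measurable_fun_shift mf.
have mAx : measurable [set v | A (v + x)] by exact: measurable_preimage_rV_shift.
split; first exact: measurable_funS msh.
rewrite /L2norm -ge0_fin_numE ?sqrte_ge0// sqrte_fin_num; last first.
  by apply: integral_ge0 => y _; rewrite lee_fin sqr_ge0.
rewrite ge0_fin_numE; last first.
  by apply: integral_ge0 => y _; rewrite lee_fin sqr_ge0.
apply: le_lt_trans (L2norm_fin foo).
rewrite -(integral_rV_shift x A (fun v => (hnorm (f v) ^+ 2)%:E)).
apply: ge0_subset_integral => //.
- exact: measurable_hnorm2 msh.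
- by move=> y _; rewrite lee_fin sqr_ge0.
Qed.

(** The left integrand lives on [A + x], a part of [A], which translates back to [A]. [phi] will be
    the real or the imaginary part. *)
Lemma Rintegral_shift_rep (phi : R[i] -> R) (f g : 'rV[R]_d -> K) : phi 0 = 0 ->
  \int[mu]_(y in A) phi (hdot (shift_rep A x f y) (g y)) =
  \int[mu]_(y in A) phi (hdot (f y) (g (y + x))).
Proof.
move=> phi0; congr fine.
pose h y := (phi (hdot (f (y - x)) (g y)))%:E.
transitivity (\int[mu]_(y in [set v | A (v - x)%R]) h y)%E.
  have -> : [set v | A (v - x)] = A `&` [set v | A (v - x)].
    apply/seteqP; split => [v /= Av|v []//]; split => //.
    by have := Ax Av; rewrite subrK.
  rewrite integral_mkcondr; apply: eq_integral => y _.
  rewrite patchE /shift_rep.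
  have -> : (y \in [set v | A (v - x)]) = (y - x \in A).
    by apply/idP/idP; rewrite !inE.
  by case: ifPn => // _; rewrite hdot0l phi0.
rewrite -(integral_rV_shift x) (_ : [set v | _] = A); last first.
  by apply/funext => v /=; rewrite addrK.
by apply: eq_integral => y _; rewrite /h addrK.
Qed.

Lemma shift_rep_is_adjoint :
  is_adjoint A (shift_rep A x : ('rV[R]_d -> K) -> _) (fun g v => g (v + x)).
Proof.
split; first exact: L2_shift.
move=> f g _ _; rewrite /L2dot.
by congr (_ +i* _)%C; apply: Rintegral_shift_rep.
Qed.

Lemma adjoint_shift_rep_eq0 (f : 'rV[R]_d -> K) : L2 A f ->
  adjoint A (shift_rep A x) f = cst 0 %[ae mu in A] ->
  \forall v \ae mu, A (v - x) -> f v = 0.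
Proof.
move=> Lf S0.
(* [adjoint] is an arbitrary choice, so only its defining property is available. *)
have [SL Sdot] : is_adjoint A (shift_rep A x) (adjoint A (shift_rep A x : ('rV[R]_d -> K) -> _)).
  by apply: xgetPex; eexists; exact: shift_rep_is_adjoint.
pose g v := f (v + x).
have Lg : L2 A g by exact: L2_shift.
(* Testing against [g] itself, the two adjoints give the square norm of [g] on one side and zero on
   the other. *)
have := Sdot g f Lg Lf; rewrite shift_rep_is_adjoint.2// => -[+ _].
rewrite /Rintegral (integral_ae0
  (f := fun y => (complex.Re (hdot (g y) (adjoint A (shift_rep A x) f y)))%:E));
  last first.
  by apply: filterS S0 => v S0 Av; rewrite S0//= hdot0r.
under eq_integral do rewrite Re_hdotxx.
have [mg goo] := Lg; have mh := measurable_hnorm2 mg.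
move=> /= /eqP; rewrite fine_eq0; last first.
  by rewrite ge0_fin_numE ?L2norm_fin// integral_ge0// => y _; rewrite lee_fin sqr_ge0.
move=> /eqP gi0.
have : ae_eq mu A (fun v => (hnorm (g v) ^+ 2)%:E) (cst 0%E).
  apply/ae_eq_integral_abs => //; rewrite -[RHS]gi0.
  by apply: eq_integral => v _; rewrite gee0_abs// lee_fin sqr_ge0.
move=> /(ae_rV_shift (- x)); apply: filterS => v h Av.
have /eqP := h Av; rewrite eqe expf_eq0 /= => /eqP /hnorm_eq0.
by rewrite /g subrK.
Qed.

End shift_rep_adjoint.

(** * From the cocycle to its densities and back *)

Theorem corollary2p6 (R : realType) (d : nat) (hd : (2 <= d)%N)
  (P : set 'rV[R]_d) (closedP : closed P) (coneP : convex_cone P)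
  (pointedP : pointed_cone P) (spanningP : spanning_cone P)
  (A : set 'rV[R]_d) (moduleA : P_module P A)
  (k : option nat) (hk : k <> Some 0%N)
  (K : hilbertType R) (sepK : separable_space K) (dimK : hilbert_dim K k)
  (xi : 'rV[R]_d -> 'rV[R]_d -> K)
  (cocycle_xi : additive_cocycle A P (shift_rep A) xi) :
  forall x, P x -> xi x = cst 0 %[ae lebesgue_rV d in A].
Proof.
have [closedA AnT A0 PA'] := moduleA.
have mA : measurable A by exact: closed_measurable_rV.
have PA a x : P x -> A a -> A (a + x) by move=> Px Aa; apply: (PA' x Px); exists a.
have [L2xi xiD adj_xi _] := cocycle_xi.
have xi0 x : P x -> \forall z \ae lebesgue_rV d, A (z - x) -> xi x z = 0.
  move=> Px; apply: adjoint_shift_rep_eq0 => //.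
  - by move=> a; exact: PA.
  - exact: L2xi.
  - exact: adj_xi.
pose g x z := (hnorm (xi x z) ^+ 2)%:E.
pose G x := g x \_ A.
have G0 x z : (0 <= G x z)%E.
  by apply: erestrict_ge0 => t _; rewrite lee_fin sqr_ge0.
have mG x : P x -> measurable_fun setT (G x).
  move=> /L2xi[mxi _]; apply/(measurable_restrictT _ mA).
  exact: measurable_hnorm2.
have Gfin x : P x -> (\int[lebesgue_rV d]_z G x z < +oo)%E.
  by move=> /L2xi[_ /L2norm_fin]; rewrite integral_mkcond.
have GD x y : P x -> P y -> \forall z \ae lebesgue_rV d,
    G (x + y) z = if z - x \in A then G y (z - x) else G x z.
  move=> Px Py; apply: filterS2 (xiD x y Px Py) (xi0 x Px) => z xyz x0.
  (* Off [A] both sides are zero, because [z - x] in [A] would put [z] in [A]. *)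
  rewrite /G /g !patchE; have [zA|zA] := boolP (z \in A); last first.
    rewrite ifF //; apply: contraNF zA; rewrite !inE => zx.
    by have := PA _ _ Px zx; rewrite subrK.
  rewrite -(xyz (set_mem zA)) /= /shift_rep; case: ifPn => zx.
    by rewrite x0 ?add0r//; exact: set_mem.
  by rewrite addr0.
move=> x Px.
(* The densities settle [A] outside [A + x]; on [A + x], [xi0] does. *)
have := density_ae_eq0 coneP mA PA G0 mG GD hd pointedP spanningP AnT Gfin Px.
apply: filterS2 (xi0 x Px) => z xz Gz Az.
have [zx|zx] := pselect (A (z - x)); first exact: xz.
have := Gz Az zx; rewrite /G patchE mem_set// => /eqP.
by rewrite eqe expf_eq0 /= => /eqP /hnorm_eq0.
Qed.
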